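(* For each connected graph $G$ and each edge $e\in E(G)$, $-1\leq D'(G-e)-D'(G)\leq 2$.
   Context: All graphs are finite and simple. The distinguishing index $D'(G)$ of a graph $G$ is the least integer $d$ such that there is an edge labeling of $G$ with $d$ labels (not required to be proper) that is preserved only by the identity automorphism of $G$. The graph $G-e$ is obtained from $G$ by removing the edge $e$ (keeping all vertices).
   Formalization: The inequality is stated only when both D'(G) and D'(G-e) exist; D' is undefined for a graph with a K_2 component or at least two isolated vertices, as happens for G-e when G is the path P_3. *)

(* Defs.v *)
From HB Require Import structures.
From mathcomp Require Import all_boot all_order all_algebra all_fingroup.

Set Implicit Arguments.
Unset Strict Implicit.
Unset Printing Implicit Defensive.

Record sgraph := SGraph {
  vertex :> finType;
  adj : rel vertex;
  adj_sym : symmetric adj;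
  adj_irr : irreflexive adj
}.

Definition edges (G : sgraph) : {set {set G}} :=
  [set [set p.1; p.2] | p : G * G & adj p.1 p.2].

Definition connected (G : sgraph) : bool :=
  (0 < #|G|) && [forall x : G, forall y : G, connect (@adj G) x y].

Section DeleteEdge.
Variables (G : sgraph) (e : {set G}).

Definition del_adj : rel G := fun x y => adj x y && ([set x; y] != e).

Lemma del_adj_sym : symmetric del_adj.
Proof. by move=> x y; rewrite /del_adj adj_sym setUC. Qed.

Lemma del_adj_irr : irreflexive del_adj.
Proof. by move=> x; rewrite /del_adj adj_irr. Qed.

Definition del_edge : sgraph := SGraph del_adj_sym del_adj_irr.

End DeleteEdge.

Definition automorphism (G : sgraph) (f : {perm G}) : bool :=
  [forall x : G, forall y : G, adj (f x) (f y) == adj x y].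

Definition edge (G : sgraph) : finType := {a : {set G} | a \in edges G}.

Definition labeling (G : sgraph) (d : nat) : finType := {ffun edge G -> 'I_d}.

Definition preserves (G : sgraph) (d : nat) (f : {perm G})
    (c : labeling G d) : bool :=
  [forall a : edge G, forall b : edge G,
    (val b == f @: val a) ==> (c b == c a)].

Definition distinguishing (G : sgraph) (d : nat) (c : labeling G d) : bool :=
  [forall f : {perm G}, automorphism f && preserves f c ==> (f == 1%g)].

Definition distinguishable (G : sgraph) (d : nat) : bool :=
  [exists c : labeling G d, distinguishing c].

(* Some graphs have no distinguishing edge labeling at all: swapping the ends
   of a K_2 component, or two isolated vertices, preserves every labeling. *)
Definition has_dist_index (G : sgraph) : Prop := exists d, distinguishable G d.

Definition dist_index (G : sgraph) (h : has_dist_index G) : nat := ex_minn h.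

(* Main.v *)
Require Import Defs.
From mathcomp Require Import all_boot all_order all_algebra all_fingroup.
From mathcomp Require Import zify.

(** The lower bound is direct ([distinguishable_add_edge]): extend a
    distinguishing labeling of [G - e] by a label used on [e] alone; an
    automorphism of [G] preserving it fixes [e], hence is an automorphism
    of [G - e].

    For the upper bound, let [c] be a distinguishing labeling of [G] with [d]
    labels and [e = uv].  An automorphism of [G - e] is one of [G] as soon as it
    fixes [e].  So it is enough to overwrite [c] with two new labels on two sets
    [A] and [B] of edges of [G - e] such that every automorphism of [G - e]
    preserving [A] and [B] fixes [e] and also each single edge of [A] and [B]:
    the second condition says that the overwritten values of [c] are still
    respected ([distinguishable_relabel]).  The choice of [A] and [B] depends on
    how [G - e] looks.

    If [u] and [v] are still connected, take a path from [u] to [v].  It has at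
    least two edges; its first edge forms [A] and the others form [B], so it
    cannot be reversed and is fixed pointwise ([path_rigid]).

    If [e] is a bridge, one of [u] and [v], say [u], keeps a neighbour, and its
    component in [G - e] is not a [K_2], since swapping the ends of a [K_2]
    component preserves every labeling.  So [u] lies on a path [p q r] with two
    edges; put [pq] in [A] and [qr] in [B].  It remains to pin [v] down by edges
    of its own component without allowing the components to be swapped.  There
    are two possibilities ([exists_anchor]).  Either there is a set of at most
    one edge such that every automorphism preserving it fixes [v]; adding it to
    [A] leaves a single edge in [B], which prevents a swap.  Or [v] is an inner vertex of a path [z v x y];
    put [zv], [vx] in [A] and [xy] in [B], and then [v] is the only vertex on
    two edges of [A] ([two_and_three_path_rigid]). *)

Set Implicit Arguments.
Unset Strict Implicit.
Unset Printing Implicit Defensive.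

(** * Unordered pairs *)

Section Pairs.
Variable T : finType.
Implicit Types (a b c d : T) (f : {perm T}).

Lemma set2_inj a b c d :
  [set a; b] = [set c; d] -> (a = c /\ b = d) \/ (a = d /\ b = c).
Proof.
move=> E.
have: a \in [set c; d] by rewrite -E set21.
have: b \in [set c; d] by rewrite -E set22.
have: c \in [set a; b] by rewrite E set21.
have: d \in [set a; b] by rewrite E set22.
by rewrite !inE => /orP[]/eqP ? /orP[]/eqP ? /orP[]/eqP ? /orP[]/eqP ?;
  intuition congruence.
Qed.

Lemma imset_set2 f a b : f @: [set a; b] = [set f a; f b].
Proof. by rewrite imsetU !imset_set1. Qed.

End Pairs.

(** * Edges, automorphisms and distinguishing labelings *)

Section Graphs.
Variable G : sgraph.
Implicit Types (x y : G) (s : {set G}) (f : {perm G}) (d : nat).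

Lemma edgesP s :
  reflect (exists x y, adj x y /\ s = [set x; y]) (s \in edges G).
Proof.
apply: (iffP imsetP) => [[[x y] /[!inE] /= xy ->]|[x [y [xy ->]]]].
  by exists x, y.
by exists (x, y); rewrite ?inE.
Qed.

Lemma set2_edges x y : ([set x; y] \in edges G) = adj x y.
Proof.
apply/edgesP/idP => [[a [b [ab /set2_inj]]]|xy]; last by exists x, y.
by move=> [[-> ->]|[-> ->]] //; rewrite adj_sym.
Qed.

Lemma adj_neq x y : adj x y -> x <> y.
Proof. by move=> xy E; move: xy; rewrite E adj_irr. Qed.

Lemma automorphismP f :
  reflect (forall x y, adj (f x) (f y) = adj x y) (automorphism f).
Proof.
apply: (iffP forallP) => [H x y|H x]; first by have /forallP/(_ y)/eqP := H x.
by apply/forallP => y; apply/eqP.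
Qed.

Lemma automorphism_edges f s :
  automorphism f -> s \in edges G -> f @: s \in edges G.
Proof.
move=> /automorphismP fP /edgesP[x [y [xy ->]]].
by rewrite imset_set2 set2_edges fP.
Qed.

(** Labels as numbers on all vertex sets: a labeling can then be compared
    between [G] and [G - e], whose edge types differ. *)
Lemma distinguishableP d :
  distinguishable G d <->
  exists l : {set G} -> nat,
    (forall s, s \in edges G -> (l s < d)%N) /\
    (forall f, automorphism f ->
       (forall s, s \in edges G -> l (f @: s) = l s) -> f = 1%g).
Proof.
split=> [/existsP[c /forallP cP]|[l [l_lt lP]]].
  pose l (s : {set G}) := if insub s is Some a then c (a : edge G) : nat else 0%N.
  exists l; split=> [s es|f fA fl].
    by rewrite /l insubT.
  have /implyP := cP f; rewrite fA /= => /(_ _)/eqP; apply.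
  apply/forallP => a; apply/forallP => b; apply/implyP => /eqP ba.
  have := fl _ (valP a); rewrite -ba /l !valK => E.
  exact/eqP/val_inj.
apply/existsP; exists [ffun a : edge G => Ordinal (l_lt _ (valP a))].
apply/forallP => f; apply/implyP => /andP[fA /forallP fc]; apply/eqP/lP => // s es.
have fes := automorphism_edges fA es.
have /forallP/(_ (Sub (f @: s) fes)) := fc (Sub s es).
by rewrite /= eqxx !ffunE /= => /eqP[].
Qed.

(** The transposition of [x] and [y] is an automorphism that maps every edge to
    itself.  With [x] and [y] isolated, or forming a [K_2] component, these are
    the obstructions to having a distinguishing labeling. *)
Lemma isolated_pair_not_distinguishable x y :
  x <> y ->
  (forall z, adj x z -> z = y) -> (forall z, adj y z -> z = x) ->
  ~ has_dist_index G.
Proof.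
move=> xy Nx Ny [d /distinguishableP[l [_ lP]]].
have out a b : adj a b -> a <> x -> a <> y -> b <> x /\ b <> y.
  move=> ab ax ay; split=> E; move: ab; rewrite E adj_sym.
    by move/Nx.
  by move/Ny.
have aut : automorphism (tperm x y).
  apply/automorphismP.
  have hom a b : adj a b -> adj (tperm x y a) (tperm x y b).
    case: tpermP => [->|->|ax ay] ab.
    - by move: (ab); rewrite (Nx _ ab) tpermR adj_sym.
    - by move: (ab); rewrite (Ny _ ab) tpermL adj_sym.
    by have [bx by_] := out _ _ ab ax ay; rewrite tpermD //; apply/eqP => /esym.
  by move=> a b; apply/idP/idP => [/hom|/hom //]; rewrite !tpermK.
have /permP/(_ x) : tperm x y = 1%g.
  apply: lP => // s /edgesP[a [b [ab ->]]]; rewrite imset_set2; congr l.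
  case: tpermP => [Ea|Ea|ax ay].
  - by subst a; rewrite (Nx _ ab) tpermR setUC.
  - by subst a; rewrite (Ny _ ab) tpermL setUC.
  by have [bx by_] := out _ _ ab ax ay; rewrite tpermD //; apply/eqP => /esym.
by rewrite tpermL perm1 => /esym.
Qed.

End Graphs.

(** * Labelings of a graph and of the graph minus an edge *)

Section DeletedEdge.
Variables (G : sgraph) (e : {set G}).
Hypothesis eG : e \in edges G.
Local Notation H := (del_edge e).
Implicit Types (s : {set G}) (f : {perm G}) (d : nat).

Lemma edges_del_edge s : (s \in edges H) = (s \in edges G) && (s != e).
Proof.
apply/edgesP/andP => [[x [y [/andP[xy ne] ->]]]|[/edgesP[x [y [xy ->]]] ne]].
  by rewrite set2_edges.
by exists x, y; split=> //; apply/andP.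
Qed.

Lemma automorphism_del_edge f :
  f @: e = e -> @automorphism H f = @automorphism G f.
Proof.
move=> fe.
have feE x y : ([set f x; f y] == e) = ([set x; y] == e).
  rewrite -imset_set2 -{1}fe; apply/eqP/eqP => [|-> //].
  exact/imset_inj/perm_inj.
have adjE (x y : G) : @adj G x y = @adj H x y || ([set x; y] == e).
  rewrite /= /del_adj; have [E|] := eqVneq; last by rewrite andbT orbF.
  by rewrite orbT -set2_edges E.
apply/(@automorphismP H)/(@automorphismP G) => fP x y.
  by rewrite !adjE feE; congr (_ || _); apply: fP.
by rewrite /= /del_adj feE fP.
Qed.

Lemma distinguishable_add_edge d :
  distinguishable H d -> distinguishable G d.+1.
Proof.
move=> /distinguishableP[l [l_lt lP]]; apply/distinguishableP.
exists (fun s => if s == e then d else l s); split=> [s sG|f fA fl].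
  case: eqVneq => // ne; apply/ltnW; rewrite ltnS; apply: l_lt.
  by rewrite edges_del_edge sG.
have fe : f @: e = e.
  have := fl e eG; rewrite eqxx; case: eqVneq => // ne E.
  have := l_lt (f @: e); rewrite edges_del_edge ne E ltnn andbT.
  by rewrite (automorphism_edges fA eG) => /(_ isT).
apply: lP => [|s]; first by rewrite automorphism_del_edge.
rewrite edges_del_edge => /andP[sG ne]; have := fl s sG.
rewrite (negbTE ne) ifN //; apply: contraNneq ne => E; apply/eqP.
by apply: (imset_inj (@perm_inj _ f)); rewrite E fe.
Qed.

(** Edges of [A] get the new label [d] and edges of [B] the new label [d.+1].
    An automorphism preserving the result preserves [A], [B] and the old labels
    outside them; since it fixes [e] and every edge of [A] and [B], it is an
    automorphism of [G] that preserves the old labels everywhere. *)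
Lemma distinguishable_relabel d (A B : {set {set G}}) :
  A \subset edges H -> B \subset edges H -> [disjoint A & B] ->
  (forall f, @automorphism H f ->
     (forall s, s \in A -> f @: s \in A) ->
     (forall s, s \in B -> f @: s \in B) ->
     f @: e = e /\ forall s, s \in A :|: B -> f @: s = s) ->
  distinguishable G d -> distinguishable H d.+2.
Proof.
move=> AH BH AB rigid /distinguishableP[l [l_lt lP]]; apply/distinguishableP.
pose l' s := if s \in A then d else if s \in B then d.+1 else l s.
have l'A s : s \in edges H -> (l' s == d) = (s \in A).
  rewrite /l' edges_del_edge => /andP[/l_lt lt _].
  case: ifP => [_|]; first exact: eqxx.
  by case: ifP => _ _; apply/eqP; lia.
have l'B s : s \in edges H -> (l' s == d.+1) = (s \in B).
  rewrite /l' edges_del_edge => /andP[/l_lt lt _].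
  case: ifP => [sA|_]; first by rewrite (disjointFr AB sA); apply/eqP; lia.
  by case: ifP => _; [rewrite eqxx | apply/eqP; lia].
exists l'; split=> [s sH|f fA fl].
  move: (sH); rewrite edges_del_edge /l' => /andP[/l_lt lt _].
  by do 2?[case: ifP => _]; lia.
have fH s : s \in edges H -> f @: s \in edges H by apply: automorphism_edges.
have [||fe fix_] := rigid f fA.
- move=> s sA; have sH := subsetP AH s sA.
  by rewrite -l'A ?fH // fl // l'A.
- move=> s sB; have sH := subsetP BH s sB.
  by rewrite -l'B ?fH // fl // l'B.
apply: lP => [|s sG]; first by rewrite -automorphism_del_edge.
have [->|ne] := eqVneq s e; first by rewrite fe.
have sH : s \in edges H by rewrite edges_del_edge sG.
have [sAB|] := boolP (s \in A :|: B); first by rewrite fix_.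
rewrite inE negb_or => /andP[sA sB].
have := fl s sH; rewrite /l' -l'A ?fH // fl // l'A // (negbTE sA).
by rewrite -l'B ?fH // fl // l'B // (negbTE sB).
Qed.

End DeletedEdge.

(** * Rigid marked paths *)

(** The first edge of the path carries one mark, all later edges another.  The
    end [p 0] is on no edge with the second mark but [p 1] is, so the first edge
    is not reversed; after that the path is followed edge by edge. *)
Lemma path_rigid (T : finType) (f : {perm T}) (p : nat -> T) n :
  (1 < n)%N ->
  (forall i j, (i <= n)%N -> (j <= n)%N -> p i = p j -> i = j) ->
  [set f (p 0); f (p 1)] = [set p 0; p 1] ->
  (forall i, (0 < i < n)%N -> exists2 j, (0 < j < n)%N &
     [set f (p i); f (p i.+1)] = [set p j; p j.+1]) ->
  forall i, (i <= n)%N -> f (p i) = p i.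
Proof.
move=> n1 pI fA fB.
have [f0 f1] : f (p 0) = p 0 /\ f (p 1) = p 1.
  case: (set2_inj fA) => // -[_ f1].
  have [|j jn] := fB 1; first by rewrite n1.
  by rewrite f1 => /set2_inj[[/pI E _]|[/pI E _]]; exfalso; lia.
suff fp i : (i < n)%N -> f (p i) = p i /\ f (p i.+1) = p i.+1.
  by case=> [//|i] /fp[].
elim: i => [//|i IH] lt; have [fi fi1] := IH (ltnW lt); split=> //.
have [|j jn] := fB i.+1; first by lia.
rewrite fi1 => /set2_inj[[/pI E ->]|[/pI E Ej]].
  by have -> : j = i.+1 by lia.
have ji : j = i by lia.
by move: Ej; rewrite ji -fi => /perm_inj/pI E'; exfalso; lia.
Qed.

(** The image of [pq] contains [f q], an end of [qr], and so cannot be an edge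
    of [F]. *)
Lemma two_path_rigid (T : finType) (f : {perm T}) p q r (F : {set {set T}}) :
  p <> q -> q <> r -> p <> r ->
  (forall s, s \in F -> q \notin s /\ r \notin s) ->
  (forall s, s \in [set p; q] |: F -> f @: s \in [set p; q] |: F) ->
  f @: [set q; r] = [set q; r] ->
  [/\ f p = p, f q = q, f r = r & forall s, s \in F -> f @: s \in F].
Proof.
move=> pq qr pr Fout fA fB.
have fpq : f @: [set p; q] = [set p; q].
  have /setU1P[//|/Fout[nq nr]] := fA _ (setU11 _ _).
  have : f q \in f @: [set q; r] by rewrite imset_f ?set21.
  have : f q \in f @: [set p; q] by rewrite imset_f ?set22.
  move=> fqA; rewrite fB => /set2P[] E; rewrite E in fqA.
    by rewrite fqA in nq.
  by rewrite fqA in nr.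
have [fp fq fr] : [/\ f p = p, f q = q & f r = r].
  move: fpq fB; rewrite !imset_set2.
  by move=> /set2_inj[[? ?]|[? ?]] /set2_inj[[? ?]|[? ?]]; split; congruence.
split=> // s sF; have /setU1P[E|//] := fA s (setU1r _ sF).
have /Fout[] := sF; suff -> : s = [set p; q] by rewrite set22.
by apply: (imset_inj (@perm_inj _ f)); rewrite E fpq.
Qed.

(** Two disjoint paths [p q r] and [z v x y], marked A B and A A B.  Having
    different lengths they cannot be exchanged. *)
Lemma two_and_three_path_rigid (T : finType) (f : {perm T}) p q r z v x y :
  uniq [:: p; q; r; z; v; x; y] ->
  let A := [set [set p; q]; [set z; v]; [set v; x]] in
  let B := [set [set q; r]; [set x; y]] in
  (forall s, s \in A -> f @: s \in A) -> (forall s, s \in B -> f @: s \in B) ->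
  [/\ f p = p, f q = q & f r = r] /\ [/\ f z = z, f v = v, f x = x & f y = y].
Proof.
move=> U A B fA fB; move: U; rewrite /= !inE !negb_or -!andbA => U.
have {}fA a b : [set a; b] \in A -> [\/ [set f a; f b] = [set p; q],
    [set f a; f b] = [set z; v] | [set f a; f b] = [set v; x]].
  by move/fA; rewrite imset_set2 !inE -orbA => /or3P[]/eqP E; constructor.
have {}fB a b : [set a; b] \in B -> [set f a; f b] = [set q; r] \/
    [set f a; f b] = [set x; y].
  by move/fB; rewrite imset_set2 !inE => /orP[]/eqP; [left|right].
have Apq : [set p; q] \in A by rewrite !inE eqxx.
have Azv : [set z; v] \in A by rewrite !inE eqxx orbT.
have Avx : [set v; x] \in A by rewrite !inE eqxx orbT.
have Bqr : [set q; r] \in B by rewrite !inE eqxx.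
have Bxy : [set x; y] \in B by rewrite !inE eqxx orbT.
do ![case/andP: U => /eqP ? U].
have fD a b : a <> b -> f a <> f b by move=> ab /perm_inj.
have Ezv := fA _ _ Azv; have Evx := fA _ _ Avx; have Epq := fA _ _ Apq.
have Eqr := fB _ _ Bqr; have Exy := fB _ _ Bxy; clear fA fB.
(* [v] is the only vertex on two edges of [A]. *)
have fv : f v = v.
  have zx : f z <> f x by apply: fD.
  by case: Ezv => /set2_inj[][? ?]; case: Evx => /set2_inj[][? ?]; congruence.
have [fx fy] : f x = x /\ f y = y.
  have vy : f v <> f y by apply: fD.
  by case: Evx => /set2_inj[][? ?]; case: Exy => /set2_inj[][? ?]; split; congruence.
have fz : f z = z.
  have zx : f z <> f x by apply: fD.
  by case: Ezv => /set2_inj[][? ?]; congruence.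
have [fp fq fr] : [/\ f p = p, f q = q & f r = r].
  have pv : f p <> f v by apply: fD.
  have qv : f q <> f v by apply: fD.
  have pr : f p <> f r by apply: fD.
  by case: Epq => /set2_inj[][? ?]; case: Eqr => /set2_inj[][? ?];
    split; congruence.
by [].
Qed.

(** * Local structure around a vertex *)

Section LocalPatterns.
Variables (K : sgraph) (hK : has_dist_index K).
Implicit Types (u v x y z : K) (f : {perm K}).

(** Edges that locate [v] without leaving its component, and that can be marked
    by one common label without losing their old labels. *)
Definition anchor v (F : {set {set K}}) :=
  [/\ F \subset edges K,
      forall s w, s \in F -> w \in s -> connect (@adj K) v w &
      forall f, automorphism f -> (forall s, s \in F -> f @: s \in F) ->
        f v = v /\ forall s, s \in F -> f @: s = s].

Lemma exists_two_path u : [exists x, adj u x] ->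
  exists p q r, [/\ adj p q, adj q r, p <> r & u \in [:: p; q; r]].
Proof.
case/existsP=> x ux.
have [/existsP[y /andP[xy /eqP yu]]|/existsPn nx] :=
    boolP [exists y, adj x y && (y != u)].
  by exists u, x, y; split=> //; [move/esym | rewrite mem_head].
have [/existsP[y /andP[uy /eqP yx]]|/existsPn nu] :=
    boolP [exists y, adj u y && (y != x)].
  by exists x, u, y; split; rewrite ?inE ?eqxx ?orbT // 1?adj_sym //; move/esym.
case: (isolated_pair_not_distinguishable (adj_neq ux) _ _ hK) => z h.
  by have := nu z; rewrite h /= negbK => /eqP.
by have := nx z; rewrite h /= negbK => /eqP.
Qed.

(** An isolated [v] is the only isolated vertex, and the empty set anchors it.
    Otherwise suppose there is no path [z v x y].  A pendant edge at [v] cannot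
    be reversed, since only one of its ends has another neighbour, so it is an
    anchor.  If there is none, then [v] is on a triangle [v x y] in which [v] and
    [x] have no neighbours outside; the edge [xy] is an anchor, because [v] is
    the only common neighbour of [x] and [y]. *)
Lemma exists_anchor v :
  (exists F, anchor v F) \/
  (exists z x y,
      [/\ adj z v, adj v x, adj x y & uniq [:: z; v; x; y]]).
Proof.
have single a b : connect (@adj K) v a -> adj a b ->
    (forall f, automorphism f -> [set f a; f b] = [set a; b] -> f v = v) ->
  exists F, anchor v F.
  move=> va ab fix_v; exists [set [set a; b]]; split.
  - by rewrite sub1set set2_edges.
  - move=> s w /set1P-> /set2P[->|->] //.
    exact: connect_trans va (connect1 ab).
  move=> f fA /(_ _ (set11 _))/set1P fab.
  by split=> [|s /set1P-> //]; apply: fix_v; rewrite -?imset_set2.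
have [/existsP[x vx]|/existsPn v_isol] := boolP [exists x, adj v x]; last first.
  left; exists set0; split=> [|s w|f /automorphismP fA _]; rewrite ?sub0set ?inE //.
  split=> [|s]; last by rewrite inE.
  apply/eqP/negPn/negP => /eqP fv.
  case: (isolated_pair_not_distinguishable fv _ _ hK) => z.
    by rewrite -(permKV f z) fA (negbTE (v_isol _)).
  by rewrite (negbTE (v_isol _)).
have [/existsP[z /existsP[a /existsP[b /and4P[]]]]|no_path] := boolP
  [exists z, exists a, exists b, [&& adj z v, adj v a, adj a b & uniq [:: z; v; a; b]]].
  by right; exists z, a, b.
left.
have {}no_path z a b : adj v z -> adj v a -> adj a b -> z <> a -> b <> v -> b = z.
  move=> vz va ab /eqP za /eqP bv; apply/eqP/negPn/negP => bz.
  move/existsPn/(_ z)/existsPn/(_ a)/existsPn/(_ b)/negP: no_path; apply.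
  rewrite (adj_sym z) vz va ab /= !inE !negb_or za (eq_sym z b) bz (eq_sym v b) bv.
  by rewrite !andbT; apply/and3P; split; apply/eqP; apply: adj_neq; rewrite // adj_sym.
have [/existsP[y /andP[xy /eqP yv]]|/existsPn nx] :=
    boolP [exists y, adj x y && (y != v)];
  have [/existsP[z /andP[vz /eqP zx]]|/existsPn nv] :=
    boolP [exists z, adj v z && (z != x)].
(* Triangle: [f v] is a common neighbour of [x] and [y]. *)
- have yz := no_path _ _ _ vz vx xy zx yv; subst z.
  apply: (single x y) => // [|f /automorphismP fA E]; first exact: connect1.
  have [fvx fvy] : adj (f v) x /\ adj (f v) y.
    have := fA v x; have := fA v y; rewrite vx vz.
    by case: (set2_inj E) => [[-> ->]|[-> ->]].
  have [//|/eqP nfv] := eqVneq (f v) v.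
  rewrite adj_sym in fvx; have := no_path _ _ _ vz vx fvx zx nfv.
  by move=> Efv; rewrite Efv adj_irr in fvy.
(* [v] is a leaf: reversing [vx] would give it a second neighbour [f y]. *)
- apply: (single v x) => // f /automorphismP fA E.
  case: (set2_inj E) => [[-> //]|[fv fx]].
  have := nv (f y); rewrite -{1}fx fA xy /= negbK -fv => /eqP/perm_inj.
  by move/yv.
(* [x] is a leaf: reversing [vx] would give it a second neighbour [f z]. *)
- apply: (single v x) => // f /automorphismP fA E.
  case: (set2_inj E) => [[-> //]|[fv fx]].
  have := nx (f z); rewrite -{1}fv fA vz /= negbK -fx => /eqP/perm_inj.
  by move/zx.
case: (isolated_pair_not_distinguishable (adj_neq vx) _ _ hK) => z h.
  by have := nv z; rewrite h /= negbK => /eqP.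
by have := nx z; rewrite h /= negbK => /eqP.
Qed.

End LocalPatterns.

(** * Two new labels suffice after deleting an edge *)

Section UpperBound.
Variables (G : sgraph) (u v : G).
Hypothesis uv : adj u v.
Local Notation H := (del_edge [set u; v]).

Lemma distinguishable_del_nonbridge d :
  connect (@adj H) u v -> distinguishable G d -> distinguishable H d.+2.
Proof.
move=> /connectP[s0 s0P Ev]; move: Ev.
case/shortenP: s0P => s sP sU _ Ev.
pose p i := nth u (u :: s) i; pose n := size s.
have pn : p n = v by rewrite /p /n -last_nth.
have pI i j : i <= n -> j <= n -> p i = p j -> i = j.
  by move=> ? ? /eqP; rewrite nth_uniq ?ltnS // => /eqP.
have pA i : i < n -> @adj H (p i) (p i.+1) by move=> ?; apply: (pathP u sP).
have n1 : 1 < n.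
  case: n pn pA {pI} => [|[|n]] //= => [E|E /(_ 0 isT)].
    by move: uv; rewrite -E adj_irr.
  by rewrite E /= /del_adj eqxx andbF.
pose A := [set [set p 0; p 1]].
pose B := [set [set p i.+1; p i.+2] | i : 'I_n.-1].
have BP a : reflect (exists2 i, 0 < i < n & a = [set p i; p i.+1]) (a \in B).
  apply: (iffP imsetP) => [[i _ ->]|[[|i] //= lt ->]].
    by exists i.+1 => //; have := ltn_ord i; lia.
  have lt' : i < n.-1 by lia.
  by exists (Ordinal lt').
have eG : [set u; v] \in edges G by rewrite set2_edges.
apply: (distinguishable_relabel eG (A := A) (B := B)).
- by rewrite sub1set (@set2_edges H) pA //; lia.
- by apply/subsetP => a /BP[i lt ->]; rewrite (@set2_edges H) pA //; lia.
- rewrite disjoints1; apply/BP => -[i lt /set2_inj[[/pI E _]|[/pI E /pI E']]]; lia.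
move=> f _ fA fB.
have fp : forall i, i <= n -> f (p i) = p i.
  apply: path_rigid => //.
    by have /set1P := fA _ (set11 _); rewrite imset_set2.
  by move=> i lt; apply/BP; rewrite -imset_set2; apply/fB/BP; exists i.
split; first by rewrite imset_set2 -pn fp // (fp 0 isT : f u = u).
move=> a /setUP[/set1P->|/BP[i lt ->]]; rewrite imset_set2 !fp //; lia.
Qed.

(** With [qr] as the only edge of [B], the path [p q r] stays in place and [F] is
    preserved by itself, although [pq] and [F] share a label. *)
Lemma distinguishable_del_anchor d (p q r : G) (F : {set {set G}}) :
  @adj H p q -> @adj H q r -> p <> r -> u \in [:: p; q; r] ->
  F \subset edges H -> (forall s, s \in F -> q \notin s /\ r \notin s) ->
  (forall f, @automorphism H f -> (forall s, s \in F -> f @: s \in F) ->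
     f v = v /\ forall s, s \in F -> f @: s = s) ->
  distinguishable G d -> distinguishable H d.+2.
Proof.
move=> pq qr pr upqr FH Fout Ffix.
have eG : [set u; v] \in edges G by rewrite set2_edges.
have npq : p <> q := @adj_neq H _ _ pq.
have nqr : q <> r := @adj_neq H _ _ qr.
apply: (distinguishable_relabel eG (A := [set p; q] |: F) (B := [set [set q; r]])).
- by rewrite subUset FH sub1set (@set2_edges H) pq.
- by rewrite sub1set (@set2_edges H).
- rewrite disjoint_sym disjoints1; apply/setU1P => -[/set2_inj|/Fout[]].
    by intuition congruence.
  by rewrite set21.
move=> f faut fA fB.
have /set1P fqr := fB _ (set11 _).
have [fp fq fr /Ffix[] // fv fF] := two_path_rigid npq nqr pr Fout fA fqr.
split.
  have fu : f u = u by move: upqr; rewrite !inE => /or3P[]/eqP->.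
  by rewrite imset_set2 fu fv.
move=> s /setUP[/setU1P[->|/fF //]|/set1P-> //].
by rewrite imset_set2 fp fq.
Qed.

Lemma distinguishable_del_paths d (p q r z x y : G) :
  @adj H p q -> @adj H q r -> u \in [:: p; q; r] ->
  @adj H z v -> @adj H v x -> @adj H x y -> uniq [:: p; q; r; z; v; x; y] ->
  distinguishable G d -> distinguishable H d.+2.
Proof.
move=> pq qr upqr zv vx xy U.
have eG : [set u; v] \in edges G by rewrite set2_edges.
apply: (distinguishable_relabel eG
  (A := [set [set p; q]; [set z; v]; [set v; x]])
  (B := [set [set q; r]; [set x; y]])).
- by rewrite !subUset !sub1set !(@set2_edges H) pq zv vx.
- by rewrite !subUset !sub1set !(@set2_edges H) qr xy.
- rewrite -setI_eq0; apply/eqP/setP => s; rewrite in_set0.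
  apply/setIP => -[sA /set2P sB].
  move: U; rewrite /= !inE !negb_or -!andbA => U.
  do ![case/andP: U => /eqP ? U].
  by move: sA => /setUP[/set2P[]|/set1P] Es; subst s;
    case: sB => /set2_inj[][? ?]; congruence.
move=> f _ fA fB.
have [[fp fq fr] [fz fv fx fy]] := two_and_three_path_rigid U fA fB.
split.
  have fu : f u = u by move: upqr; rewrite !inE => /or3P[]/eqP->.
  by rewrite imset_set2 fu fv.
by move=> s /setUP[/setUP[/set2P[]|/set1P]|/set2P[]]->;
  rewrite imset_set2 ?fp ?fq ?fr ?fz ?fv ?fx ?fy.
Qed.

(** Everything near [v] avoids [p], [q] and [r], because [u] and [v] lie in
    different components of [G - e]. *)
Lemma distinguishable_del_bridge d :
  has_dist_index H -> [exists x, @adj H u x] -> ~~ connect (@adj H) u v ->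
  distinguishable G d -> distinguishable H d.+2.
Proof.
move=> hH u_deg nconn.
have Hsym : connect_sym (@adj H) := sym_connect_sym (@adj_sym H).
have [p [q [r [pq qr pr upqr]]]] := exists_two_path hH u_deg.
have [up uq ur] : [/\ connect (@adj H) u p, connect (@adj H) u q &
                      connect (@adj H) u r].
  have cpq := connect1 pq; have cqr := connect1 qr.
  have cqp : connect (@adj H) q p by rewrite Hsym.
  have crq : connect (@adj H) r q by rewrite Hsym.
  have cpr := connect_trans cpq cqr; have crp := connect_trans crq cqp.
  suff conn a : a \in [:: p; q; r] ->
      [/\ connect (@adj H) a p, connect (@adj H) a q & connect (@adj H) a r].
    exact: conn upqr.
  by rewrite !inE => /or3P[]/eqP->; split; rewrite ?connect0.
have sep a b : connect (@adj H) u a -> connect (@adj H) v b -> a != b.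
  move=> ua vb; apply: contraNneq nconn => E; subst b.
  by apply: connect_trans ua _; rewrite Hsym.
case: (exists_anchor hH v) => [[F [FH Fconn Ffix]]|[z [x [y [zv vx xy U]]]]].
  apply: (distinguishable_del_anchor pq qr pr upqr FH) => // s sF.
  by split; apply/negP => /(Fconn _ _ sF); [move/(sep _ _ uq) | move/(sep _ _ ur)];
    rewrite eqxx.
apply: (distinguishable_del_paths pq qr upqr zv vx xy).
have vz : connect (@adj H) v z by rewrite Hsym connect1.
have cvx := connect1 vx.
have vy := connect_trans cvx (connect1 xy).
rewrite (cat_uniq [:: p; q; r] [:: z; v; x; y]) U andbT; apply/andP; split.
  rewrite /= !inE negb_or !andbT -andbA.
  by apply/and3P; split; apply/eqP => //; apply: (@adj_neq H).
by rewrite /= !inE !negb_or !(eq_sym _ p) !(eq_sym _ q) !(eq_sym _ r) !sep.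
Qed.

End UpperBound.

Lemma distinguishable_del_edge (G : sgraph) (e : {set G}) d :
  e \in edges G -> has_dist_index (del_edge e) ->
  distinguishable G d -> distinguishable (del_edge e) d.+2.
Proof.
case/edgesP=> u [v [uv ->]] hH.
have [conn|nconn] := boolP (connect (@adj (del_edge [set u; v])) u v).
  exact: distinguishable_del_nonbridge.
have [u_deg|/existsPn u_isol] := boolP [exists x, @adj (del_edge [set u; v]) u x].
  exact: distinguishable_del_bridge.
have [v_deg|/existsPn v_isol] := boolP [exists x, @adj (del_edge [set u; v]) v x].
  rewrite setUC in hH nconn v_deg *.
  apply: distinguishable_del_bridge; rewrite // 1?adj_sym //.
  by rewrite (sym_connect_sym (@adj_sym (del_edge [set v; u]))).
case: (@isolated_pair_not_distinguishable (del_edge [set u; v]) u v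
         (adj_neq uv) _ _ hH) => z.
  by rewrite (negbTE (u_isol z)).
by rewrite (negbTE (v_isol z)).
Qed.

(** * The distinguishing index *)

Import Order.TTheory GRing.Theory Num.Theory.
Local Open Scope ring_scope.

Theorem theorem2p6 (G : sgraph) (e : {set G})
    (G_conn : connected G) (eG : e \in edges G)
    (hG : has_dist_index G) (hGe : has_dist_index (del_edge e)) :
  (- 1 <= (dist_index hGe)%:Z - (dist_index hG)%:Z) /\
  ((dist_index hGe)%:Z - (dist_index hG)%:Z <= 2%:Z).
Proof.
rewrite /dist_index; case: ex_minnP => m Hm m_min; case: ex_minnP => n Gn n_min.
have := n_min _ (distinguishable_add_edge eG Hm).
have := m_min _ (distinguishable_del_edge eG hGe Gn).
by lia.
Qed.
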